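(* Let $n$ be a positive integer and $r,k,h$ integers. Suppose $(n,k)=1$, $r>1$, and $h(r-1)\equiv 0\bmod n$. Then $R(r,n,k,h)$ is the metacyclic group \[B\left((n,h)(r^n-1)/n,\ n/(n,h),\ r^{(n-1)h\bar{A}},\ 1\right)\] of order $r^n-1$, where $((r-1)h+k)\bar{A}\equiv 1\bmod n$.
   Context: $(a,b)$ denotes the greatest common divisor, with $(n,0)=n$. For a word $w$ in $x_0,\dots,x_{n-1}$, $G_n(w)=\langle x_0,\dots,x_{n-1}\mid w,\theta(w),\dots,\theta^{n-1}(w)\rangle$ where $\theta(x_i)=x_{i+1}$, subscripts modulo $n$. For $r,s>0$, $P(r,n,l,s,f)=G_n\big((x_0x_f\cdots x_{(r-1)f})(x_{(l-1)}x_{(l-1)+f}\cdots x_{(l-1)+(s-1)f})^{-1}\big)$, and $R(r,n,k,h)=P(r,n,(r-1)h+k+1,1,h)$, i.e. $R(r,n,k,h)=G_n\big((x_0x_h\cdots x_{(r-1)h})x_{(r-1)h+k}^{-1}\big)$. For integers $M,N,R,\lambda$ with $R^N\equiv 1\bmod M$, $B(M,N,R,\lambda)=\langle a,b\mid a^M=1,\ bab^{-1}=a^R,\ b^N=a^{\lambda M/(M,R-1)}\rangle$. The parameter $R$ matters only modulo $M$; powers of $r$ with possibly negative exponents are read modulo $r^n-1$. A group is metacyclic if it has a cyclic normal subgroup with cyclic quotient. *)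

(* Defs.v *)
From HB Require Import structures.
From mathcomp Require Import all_boot all_order all_algebra.
From mathcomp Require Import boolp.

Set Implicit Arguments.
Unset Strict Implicit.
Unset Printing Implicit Defensive.

Import GRing.Theory Num.Theory.

(* A letter (x, false) stands for the generator x and (x, true) for x^-1.     *)
Notation word X := (seq (X * bool)).

Definition inv_letter (X : Type) (a : X * bool) : X * bool := (a.1, ~~ a.2).

Definition inv_word (X : Type) (w : word X) : word X :=
  rev (map (@inv_letter X) w).

Definition exp_word (X : Type) (w : word X) (e : int) : word X :=
  match e with
  | Posz m => flatten (nseq m w)
  | Negz m => flatten (nseq m.+1 (inv_word w))
  end.

(* Since concatenation is respected on both sides, this is equality of words  *)
(* modulo the normal closure of the relators in the free group on X.          *)
Inductive word_eq (X : eqType) (rels : seq (word X)) : word X -> word X -> Prop :=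
| WordEqRefl w : word_eq rels w w
| WordEqSym w1 w2 : word_eq rels w1 w2 -> word_eq rels w2 w1
| WordEqTrans w1 w2 w3 :
    word_eq rels w1 w2 -> word_eq rels w2 w3 -> word_eq rels w1 w3
| WordEqCat u1 u2 v1 v2 :
    word_eq rels u1 u2 -> word_eq rels v1 v2 -> word_eq rels (u1 ++ v1) (u2 ++ v2)
| WordEqCancel a : word_eq rels [:: a; inv_letter a] [::]
| WordEqRel w : w \in rels -> word_eq rels w [::].

Lemma inv_letterK (X : Type) : involutive (@inv_letter X).
Proof. by case=> x b; rewrite /inv_letter /= negbK. Qed.

Lemma inv_wordK (X : Type) : involutive (@inv_word X).
Proof.
by move=> w; rewrite /inv_word map_rev revK mapK //; apply: inv_letterK.
Qed.

Section PresentedGroup.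
Context (X : choiceType) (rels : seq (word X)).

Local Notation "u ~ v" := (word_eq rels u v) (at level 70).

Lemma word_eq_invr (w : word X) : w ++ inv_word w ~ [::].
Proof.
elim: w => [|a w IHw]; first exact: WordEqRefl.
have -> : (a :: w) ++ inv_word (a :: w)
    = [:: a] ++ (w ++ inv_word w) ++ [:: inv_letter a].
  by rewrite /inv_word /= rev_cons -cats1 catA.
apply: (WordEqTrans _ (WordEqCancel rels a)).
apply: (WordEqCat (WordEqRefl rels [:: a])).
rewrite -[X in _ ~ X]cat0s.
by apply: WordEqCat => //; apply: WordEqRefl.
Qed.

Lemma word_eq_invl (w : word X) : inv_word w ++ w ~ [::].
Proof. by have := word_eq_invr (inv_word w); rewrite inv_wordK. Qed.

Lemma word_eq_inv (u v : word X) : u ~ v -> inv_word u ~ inv_word v.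
Proof.
move=> uv; apply: (@WordEqTrans _ _ _ (inv_word u ++ (v ++ inv_word v))).
  rewrite -[X in X ~ _]cats0; apply: WordEqCat; first exact: WordEqRefl.
  exact/WordEqSym/word_eq_invr.
rewrite catA -[X in _ ~ X]cat0s; apply: WordEqCat; last exact: WordEqRefl.
apply: WordEqTrans (word_eq_invl u).
by apply: WordEqCat; [apply: WordEqRefl | apply: WordEqSym].
Qed.

Definition word_eqb (u v : word X) : bool := `[< u ~ v >].

Lemma word_eqb_refl : reflexive word_eqb.
Proof. by move=> u; apply/asboolP; apply: WordEqRefl. Qed.

Lemma word_eqb_sym : symmetric word_eqb.
Proof. by move=> u v; apply/asboolP/asboolP => /WordEqSym. Qed.

Lemma word_eqb_trans : transitive word_eqb.
Proof.
by move=> v u w /asboolP uv /asboolP vw; apply/asboolP; apply: WordEqTrans vw.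
Qed.

Canonical word_equiv :=
  EquivRel word_eqb word_eqb_refl word_eqb_sym word_eqb_trans.

Definition presented : Type := {eq_quot word_equiv}%qT.

HB.instance Definition _ := Choice.on presented.
HB.instance Definition _ : EqQuotient _ word_equiv presented :=
  EqQuotient.on presented.

Definition presented_one : presented := \pi_presented%qT [::].
Definition presented_mul (a b : presented) : presented :=
  \pi_presented%qT (repr a ++ repr b).
Definition presented_inv (a : presented) : presented :=
  \pi_presented%qT (inv_word (repr a)).

Lemma presented_eqP (u v : word X) :
  \pi_presented%qT u = \pi_presented%qT v <-> u ~ v.
Proof.
split=> [/eqP|uv]; first by rewrite eqmodE => /asboolP.
by apply/eqP; rewrite eqmodE; apply/asboolP.
Qed.

Lemma repr_presented (u : word X) : repr (\pi_presented%qT u) ~ u.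
Proof. by apply/presented_eqP; rewrite reprK. Qed.

Lemma presented_mulA : associative presented_mul.
Proof.
move=> a b c; apply/presented_eqP.
apply: (@WordEqTrans _ _ _ (repr a ++ (repr b ++ repr c))).
  by apply: WordEqCat; [apply: WordEqRefl | apply: repr_presented].
rewrite catA; apply: WordEqCat; last exact: WordEqRefl.
exact/WordEqSym/repr_presented.
Qed.

Lemma presented_mul1 : left_id presented_one presented_mul.
Proof.
move=> a; rewrite -[RHS](reprK a); apply/presented_eqP.
rewrite -[X in _ ~ X]cat0s.
by apply: WordEqCat; [apply: repr_presented | apply: WordEqRefl].
Qed.

Lemma presented_mul1r : right_id presented_one presented_mul.
Proof.
move=> a; rewrite -[RHS](reprK a); apply/presented_eqP.
rewrite -[X in _ ~ X]cats0.
by apply: WordEqCat; [apply: WordEqRefl | apply: repr_presented].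
Qed.

Lemma presented_mulV : left_inverse presented_one presented_inv presented_mul.
Proof.
move=> a; apply/presented_eqP; apply: WordEqTrans (word_eq_invl (repr a)).
by apply: WordEqCat; [apply: repr_presented | apply: WordEqRefl].
Qed.

Lemma presented_mulVr : right_inverse presented_one presented_inv presented_mul.
Proof.
move=> a; apply/presented_eqP; apply: WordEqTrans (word_eq_invr (repr a)).
by apply: WordEqCat; [apply: WordEqRefl | apply: repr_presented].
Qed.

HB.instance Definition _ := isGroup.Build presented
  presented_mulA presented_mul1 presented_mul1r presented_mulV presented_mulVr.

End PresentedGroup.

Definition group_iso (G H : groupType) : Prop :=
  exists f : {multiplicative G -> H}, bijective f.

Local Open Scope ring_scope.

Section CyclicPresentations.
Context (n : nat) (n_gt0 : (0 < n)%N).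

Lemma subscript_subproof (i : int) : (`|(i %% n)%Z| < n)%N.
Proof.
by rewrite -ltz_nat gez0_abs ?modz_ge0 ?ltz_pmod // eqz_nat -lt0n.
Qed.

Definition subscript (i : int) : 'I_n := Ordinal (subscript_subproof i).

Definition shift_word (w : word 'I_n) : word 'I_n :=
  [seq (ordS a.1, a.2) | a <- w].

Definition cyclically_presented (w : word 'I_n) : groupType :=
  presented [seq iter j shift_word w | j <- iota 0 n].

(* x_i x_(i+f) ... x_(i+(m-1)f) *)
Definition progression_word (m : nat) (i f : int) : word 'I_n :=
  [seq (subscript (i + j%:Z * f), false) | j <- iota 0 m].

Definition P_group (r : nat) (l : int) (s : nat) (f : int) : groupType :=
  cyclically_presented
    (progression_word r 0 f ++ inv_word (progression_word s (l - 1) f)).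

Definition R_group (r : nat) (k h : int) : groupType :=
  P_group r ((r%:Z - 1) * h + k + 1) 1 h.

End CyclicPresentations.

(* The exponent lam * M / (M, R - 1) is an exact division; when M = 0 and     *)
(* R = 1 the library's division by 0 gives 0. The condition R ^ N = 1 mod M   *)
(* under which the notation is used is not built in.                          *)
Definition B_relators (M N R lam : int) : seq (word 'I_2) :=
  let a := [:: (ord0, false)] in
  let b := [:: (ord_max, false)] in
  [:: exp_word a M;
      b ++ a ++ inv_word b ++ inv_word (exp_word a R);
      exp_word b N ++ inv_word (exp_word a ((lam * M) %/ gcdz M (R - 1))%Z)].

Definition B_group (M N R lam : int) : groupType := presented (B_relators M N R lam).

(* q represents r ^ e modulo m; for e < 0 the power is that of the inverse of *)
(* r modulo m.                                                                *)
Definition represents_power (m r e q : int) : Prop :=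
  match e with
  | Posz j => (q = r ^+ j %[mod m])%Z
  | Negz j => (q * r ^+ j.+1 = 1 %[mod m])%Z
  end.

(* Main.v *)
Require Import Defs.
From HB Require Import structures.
From mathcomp Require Import all_boot all_order all_algebra all_fingroup all_solvable.
From mathcomp Require Import ring.

Set Implicit Arguments.
Unset Strict Implicit.
Unset Printing Implicit Defensive.

Import GRing.Theory Num.Theory.

(** Write c = (r-1)h + k, Q = r^n - 1, d = (n,h) and N = n/d.

    Adjoin to R(r,n,k,h) an element t of order n with t x_i t^-1 = x_(i+1),
    and put y = x_0 t^h.  As h (r-1) = 0 mod n, the defining relations become
    the single relation y^r = t^c y t^-c, so the extended group is the
    semidirect product of a cyclic group of order Q, generated by y, with
    <t^c>, and t acts on y as the power r^A.  R(r,n,k,h) consists of the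
    elements y^i t^(-ih), and multiplying two of them gives
        i o j = i + p^i j   mod Q,   where p = r^(-hA).
    This is a group law on the residues mod Q because p = 1 mod N and
    p^N = 1 mod Q: the hypothesis on h says exactly that N divides r-1.

    The proof below does not construct the extension.  It takes this law as
    the definition of a finite group (twisted), which visibly has order Q, and
    compares both presentations with it.

    - R(r,n,k,h) (R_group_iso_twisted).  The element y^i t^(-ih) is the word
      x_0 x_h ... x_((i-1)h), so the residue i is sent to this product (run).
      A product of r consecutive factors is one generator (run_mulr), and
      iterating n times gives back the first generator; hence such products
      depend on their length mod Q only (run_modn), and they multiply by the
      law above (run_mul).  The inverse map is x_m |-> r^(mA).

    - B(M,N,q,1) (B_group_iso_twisted).  One sends a to the residue N and b to
      the residue 1.  Every element of B is some a^l b^k, and its image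
      determines it.  The relation for b^N asks that
      1 + p + ... + p^(N-1) be N M / (M,q-1) mod Q.  Since p is a power of r^d
      with exponent prime to N, the summands are those of
      1 + r^d + ... + r^(d(N-1)) = Q / (r^d - 1) in another order
      (sum_exp_coprime), and (M,q-1) = r^d - 1 (gcdn_exp_pred).

    The residues divisible by N form the cyclic normal subgroup <a>, and <b>
    covers the quotient, so the group is metacyclic. *)

(** * Isomorphisms of groups *)

Section GroupIsomorphism.
Local Open Scope group_scope.

Lemma group_iso_morph (G H : groupType) (f : G -> H) :
  {morph f : x y / x * y} -> bijective f -> group_iso G H.
Proof.
move=> fM f_bij; pose fHB := isMultiplicative.Build G H f fM.
pose F : {multiplicative G -> H} := HB.pack f fHB.
by exists F.
Qed.

Lemma group_iso_sym (G H : groupType) : group_iso G H -> group_iso H G.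
Proof.
case=> f [g fK gK]; apply: (group_iso_morph (can2_gmulfM fK gK)).
by exists f.
Qed.

Lemma group_iso_trans (G H K : groupType) :
  group_iso G H -> group_iso H K -> group_iso G K.
Proof. by case=> f f_bij [g g_bij]; exists (g \o f); apply: bij_comp. Qed.

Lemma inj_surj_bij (T U : Type) (f : T -> U) (g : U -> T) :
  injective f -> cancel g f -> bijective f.
Proof. by move=> f_inj gK; exists g => // x; apply: f_inj; rewrite gK. Qed.

End GroupIsomorphism.

(** * Values of words and the universal property *)

Section WordValue.
Local Open Scope group_scope.
Variables (X : Type) (G : groupType) (f : X -> G).

Definition letter_value (a : X * bool) : G :=
  if a.2 then (f a.1)^-1 else f a.1.

Definition word_value (w : word X) : G := \prod_(a <- w) letter_value a.

Lemma word_value_cat u v : word_value (u ++ v) = word_value u * word_value v.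
Proof. exact: big_cat. Qed.

Lemma word_value_letter x : word_value [:: (x, false)] = f x.
Proof. exact: big_seq1. Qed.

Lemma word_value_inv w : word_value (inv_word w) = (word_value w)^-1.
Proof.
elim: w => [|a w IHw]; first by rewrite /word_value !big_nil invg1.
rewrite /inv_word map_cons rev_cons -cats1 word_value_cat [in LHS]IHw.
rewrite /word_value big_seq1 big_cons invgM; congr (_ * _).
by rewrite /letter_value /=; case: a.2; rewrite ?invgK.
Qed.

Lemma word_value_exp w m : word_value (exp_word w m%:Z) = word_value w ^+ m.
Proof.
rewrite /=; elim: m => [|m IHm]; first exact: big_nil.
by rewrite [flatten _]/= word_value_cat IHm expgS.
Qed.

(** Integer exponents are compared with natural ones, so that all computations
    in groups use natural powers. *)
Lemma word_value_expz w (e : int) M m :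
    word_value w ^+ M = 1 -> (e = m%:Z %[mod M%:Z])%Z ->
  word_value (exp_word w e) = word_value w ^+ m.
Proof.
move=> wM1; have wX i : M %| i -> word_value w ^+ i = 1.
  by case/dvdnP=> t ->; rewrite mulnC expgnA wM1 expg1n.
case: e => j /eqP; rewrite eqz_mod_dvd => Mdv.
  rewrite word_value_exp.
  case/orP: (leq_total m j) => [le_mj|le_jm].
    move: Mdv; rewrite subzn // dvdzE !absz_nat => /wX.
    by rewrite expgnFr // => /divg1_eq.
  rewrite -rpredN opprB subzn // dvdzE !absz_nat in Mdv.
  by have := wX _ Mdv; rewrite expgnFr // => /divg1_eq.
rewrite -[Negz j]/(- (j.+1)%:Z)%R -opprD rpredN -PoszD dvdzE !absz_nat in Mdv.
transitivity (word_value (exp_word (inv_word w) j.+1%:Z)); first by [].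
rewrite word_value_exp word_value_inv expVgn; apply: mulg1_eq.
by rewrite -expgnDr wX.
Qed.

End WordValue.

Section UniversalProperty.
Local Open Scope group_scope.
Variables (X : choiceType) (rels : seq (word X)).

Definition word_class (w : word X) : presented rels :=
  \pi_(presented rels)%qT w.

Definition presented_gen (x : X) : presented rels := word_class [:: (x, false)].

Lemma word_class_cat u v : word_class (u ++ v) = word_class u * word_class v.
Proof.
by apply/presented_eqP; apply: WordEqCat; apply: WordEqSym;
  apply: repr_presented.
Qed.

(** The class of a word is its value at the generators; all facts about classes
    thus become facts about [word_value], in which inversion and powers have
    already been computed. *)
Lemma word_classE w : word_class w = word_value presented_gen w.
Proof.
elim: w => [|[x b] w IHw]; first by rewrite /word_value big_nil.
rewrite -cat1s word_class_cat word_value_cat IHw; congr (_ * _).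
rewrite /word_value big_seq1 /letter_value; case: b => //=.
apply/eqP; rewrite -mulg_eq1 -word_class_cat; apply/eqP/presented_eqP.
exact: (WordEqCancel rels (x, true)).
Qed.

Lemma presented_gen_rel w : w \in rels -> word_value presented_gen w = 1.
Proof. by rewrite -word_classE => wR; apply/presented_eqP/WordEqRel. Qed.

Lemma presented_ind (P : presented rels -> Prop) :
    P 1 -> (forall x g, P g -> P (presented_gen x * g)) ->
    (forall x g, P g -> P ((presented_gen x)^-1 * g)) ->
  forall g, P g.
Proof.
move=> P1 PM PV g; have -> : g = word_value presented_gen (generic_quotient.repr g).
  by rewrite -word_classE; apply/esym/reprK.
elim: (generic_quotient.repr g) => [|[x b] w IHw]; first by rewrite /word_value big_nil.
rewrite /word_value big_cons /letter_value; case: b => /=; [exact: PV|exact: PM].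
Qed.

(** The universal property: word equality is the smallest congruence for which
    the relators and the cancellations are trivial, so it is contained in the
    equality of values under [f]. *)
Lemma presented_morphism (G : groupType) (f : X -> G) :
    (forall w, w \in rels -> word_value f w = 1) ->
  exists phi : UMagmaMorphism.type (presented rels) G,
    forall x, phi (presented_gen x) = f x.
Proof.
move=> f_rel.
have f_eq u v : word_eq rels u v -> word_value f u = word_value f v.
  elim=> {u v} [//|u v _ -> //|u v w _ -> _ -> //|u1 u2 v1 v2 _ IHu _ IHv||].
  - by rewrite !word_value_cat IHu IHv.
  - move=> [x b]; rewrite /word_value big_cons big_seq1 big_nil.
    by rewrite /letter_value; case: b => /=; rewrite ?mulgV ?mulVg.
  by move=> w /f_rel ->; rewrite /word_value big_nil.
pose F (g : presented rels) := word_value f (generic_quotient.repr g).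
have F_class w : F (word_class w) = word_value f w.
  exact/f_eq/repr_presented.
have F_morph : monoid.monoid_morphism F.
  split; first by rewrite -[1]/(word_class [::]) F_class /word_value big_nil.
  by move=> g1 g2; rewrite -[LHS]/(F (word_class _)) F_class word_value_cat.
pose FHB := isUMagmaMorphism.Build _ _ F F_morph.
pose phi : UMagmaMorphism.type _ _ := HB.pack F FHB.
by exists phi => x; rewrite [LHS]F_class word_value_letter.
Qed.

End UniversalProperty.

Arguments presented_gen {X} rels x.

(** * Congruences and powers of an integer *)

Lemma expn_mod a p m i j :
  a ^ p = 1 %[mod m] -> i = j %[mod p] -> a ^ i = a ^ j %[mod m].
Proof.
move=> ap1 ij.
have aE k : a ^ k = a ^ (k %% p) %[mod m].
  rewrite {1}(divn_eq k p) expnD mulnC (mulnC _ p) expnM -modnMmr -modnXm.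
  by rewrite ap1 modnXm exp1n modnMmr muln1.
by rewrite aE ij -aE.
Qed.

Lemma modn_mulr a b c m : a = b %[mod m] -> c * a = c * b %[mod m].
Proof. by move=> ab; rewrite -modnMmr ab modnMmr. Qed.

Lemma modn_addl a b c m : a = b %[mod m] -> c + a = c + b %[mod m].
Proof. by move=> ab; rewrite -modnDmr ab modnDmr. Qed.

Lemma modn_addr a b c m : a = b %[mod m] -> a + c = b + c %[mod m].
Proof. by move=> ab; rewrite -modnDml ab modnDml. Qed.

Lemma modn_sum1 m k (F : nat -> nat) :
  (forall j, F j = 1 %[mod m]) -> \sum_(0 <= j < k) F j = k %[mod m].
Proof.
move=> F1; elim: k => [|k IHk]; first by rewrite big_geq.
by rewrite big_nat_recr //= -modnDm IHk F1 modnDm addn1.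
Qed.

Lemma modz_shift (t i j d : int) : i = (j + t * d)%R -> (i = j %[mod d])%Z.
Proof. by move=> ->; rewrite addrC modzMDl. Qed.

Lemma gcdn_divn_coprime n m : 0 < n -> coprime (n %/ gcdn n m) (m %/ gcdn n m).
Proof.
move=> n_gt0; have d_gt0 : 0 < gcdn n m by rewrite gcdn_gt0 n_gt0.
rewrite /coprime -(eqn_pmul2r d_gt0) mul1n muln_gcdl.
by rewrite !divnK ?dvdn_gcdl ?dvdn_gcdr.
Qed.

(** Modulo a common divisor g of both numbers, r^a = r^b = 1, and a Bezout
    relation between a and b turns this into r^(a,b) = 1. *)
Lemma gcdn_exp_pred r a b : 0 < r -> 0 < a ->
  gcdn (r ^ a - 1) (r ^ b - 1) = r ^ gcdn a b - 1.
Proof.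
move=> r_gt0 a_gt0.
have dvdE g i : (g %| r ^ i - 1) = (r ^ i == 1 %[mod g]).
  by rewrite eqn_mod_dvd ?expn_gt0 ?r_gt0.
have dvdX g i j : g %| r ^ i - 1 -> i %| j -> g %| r ^ j - 1.
  rewrite !dvdE => /eqP ri1 /dvdnP[k ->]; apply/eqP; rewrite mulnC.
  by rewrite -(expn0 r); apply: expn_mod ri1 _; rewrite mod0n modnMr.
apply/eqP; rewrite eqn_dvd; apply/andP; split; last first.
  rewrite dvdn_gcd; apply/andP.
  by split; apply: (dvdX _ (gcdn a b)); rewrite ?dvdn_gcdl ?dvdn_gcdr.
set g := gcdn _ _; have [k _ ka] := Bezoutl b a_gt0.
have rkb : r ^ (k * b) = 1 %[mod g].
  by apply/eqP; rewrite -dvdE (dvdX _ b) ?dvdn_gcdr // dvdn_mull.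
have : g %| r ^ (gcdn a b + k * b) - 1 by rewrite (dvdX _ a) ?dvdn_gcdl.
by rewrite !dvdE expnD -modnMmr rkb modnMmr muln1.
Qed.

(** The exponents matter mod N only, and multiplication by k permutes the
    residues mod N: both sums have the same terms. *)
Lemma sum_exp_coprime g N k m : g ^ N = 1 %[mod m] -> coprime N k ->
  \sum_(0 <= j < N) (g ^ k) ^ j = \sum_(0 <= j < N) g ^ j %[mod m].
Proof.
case: N => [|N] gN1 cNk; first by rewrite !big_geq.
pose s (j : 'I_N.+1) : 'I_N.+1 := Ordinal (ltn_pmod (k * j) (ltn0Sn N)).
have s_inj : injective s.
  move=> i j /(congr1 (@nat_of_ord _)) /= ij; apply: val_inj => /=.
  wlog le_ji : i j ij / j <= i.
    by move=> W; case/orP: (leq_total j i) => le; [|apply/esym]; apply: W.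
  move/eqP: ij; rewrite eqn_mod_dvd ?leq_mul2l ?le_ji ?orbT // -mulnBr.
  rewrite Gauss_dvdr // => Ndv; apply/eqP; rewrite eqn_leq le_ji andbT leqNgt.
  apply: contraL Ndv => lt_ji; rewrite gtnNdvd ?subn_gt0 //.
  exact: leq_ltn_trans (leq_subr _ _) (ltn_ord i).
rewrite !big_mkord [in RHS](reindex_inj s_inj) /=.
rewrite -modn_summ -[RHS]modn_summ; congr (_ %% _); apply: eq_bigr => j _.
by rewrite -expnM; apply: expn_mod gN1 _; rewrite modn_mod.
Qed.

Lemma PoszX (m i : nat) : Posz (m ^ i) = (Posz m ^+ i)%R.
Proof. by elim: i => // i IHi; rewrite expnS PoszM IHi exprS. Qed.

Section PowerOfInteger.
Variables (n r : nat).
Hypotheses (n_gt0 : 0 < n) (r_gt0 : 0 < r).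
Local Notation Q := (r ^ n - 1).

(** Powers of r with integer exponents modulo r^n - 1: as r has order dividing n,
    the exponent is first reduced to a natural number below n. *)
Definition rpow (z : int) : nat := r ^ `|(z %% n%:Z)%Z|.

Lemma rpow_mod z w : (z = w %[mod n%:Z])%Z -> rpow z = rpow w.
Proof. by rewrite /rpow => ->. Qed.

Lemma expn_modulus : r ^ n = 1 %[mod Q].
Proof. by apply/eqP; rewrite eqn_mod_dvd ?expn_gt0 ?r_gt0. Qed.

Lemma absz_modz z : Posz `|(z %% n%:Z)%Z| = (z %% n%:Z)%Z.
Proof. by rewrite gez0_abs // modz_ge0 // eqz_nat -lt0n. Qed.

Lemma rpow_nat j : rpow j%:Z = r ^ j %[mod Q].
Proof.
apply: expn_mod expn_modulus _; apply/eqP.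
by rewrite -eqz_nat -!modz_nat absz_modz modz_mod.
Qed.

Lemma rpowD z w : rpow (z + w)%R = rpow z * rpow w %[mod Q].
Proof.
rewrite -expnD; apply: expn_mod expn_modulus _; apply/eqP.
by rewrite -eqz_nat -!modz_nat PoszD !absz_modz modz_mod modzDml modzDmr.
Qed.

Lemma represents_power_rpow (E q : int) :
    represents_power (r%:Z ^+ n - 1)%R r%:Z E q ->
  (q = (rpow E)%:Z %[mod Q%:Z])%Z.
Proof.
have QE : (r%:Z ^+ n - 1)%R = Posz Q.
  by rewrite -subzn ?expn_gt0 ?r_gt0 // PoszX.
rewrite /represents_power QE; case: E => j.
  move=> ->; apply/eqP; rewrite -PoszX !modz_nat eqz_nat.
  by apply/eqP/esym/rpow_nat.
move=> qr1; have : rpow (Negz j) * r ^ j.+1 = 1 %[mod Q].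
  rewrite -modnMmr -rpow_nat modnMmr -rpowD NegzE addNr.
  by rewrite /rpow mod0z.
move=> /(congr1 Posz); rewrite -!modz_nat PoszM => rr1.
rewrite -[q]mulr1 -modzMmr -rr1 modzMmr mulrCA -modzMmr.
by rewrite PoszX qr1 modzMmr mulr1.
Qed.

End PowerOfInteger.

(** * Twisted cyclic groups *)

(** The two congruences are what makes i + p^i j associative: the first makes
    p^i depend on i mod N only, the second makes the law additive mod N. *)
Record twist := Twist {
  modulus : nat;
  period : nat;
  base : nat;
  modulus_gt0 : 0 < modulus;
  period_dvd : period %| modulus;
  base_period : base ^ period = 1 %[mod modulus];
  base1 : base = 1 %[mod period] }.

Definition twisted (T : twist) : Type := 'I_(modulus T).

HB.instance Definition _ (T : twist) := Finite.on (twisted T).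

Section TwistedGroup.
Variable T : twist.
Local Notation Q := (modulus T).
Local Notation N := (period T).
Local Notation p := (base T).

Lemma base_exp1 i : p ^ i = 1 %[mod N].
Proof. by rewrite -modnXm base1 modnXm exp1n. Qed.

Lemma base_expM i a : p ^ (i * p ^ a) = p ^ i %[mod Q].
Proof.
apply: expn_mod (base_period T) _.
by rewrite -modnMmr base_exp1 modnMmr muln1.
Qed.

Lemma modn_period i j : i = j %[mod Q] -> i = j %[mod N].
Proof.
by move=> ij; rewrite -(modn_dvdm _ (period_dvd T)) ij modn_dvdm ?period_dvd.
Qed.

Definition residue i : twisted T := Ordinal (ltn_pmod i (modulus_gt0 T)).

Lemma residueP i j : residue i = residue j <-> i = j %[mod Q].
Proof.
split=> [/(congr1 (@nat_of_ord _)) //|ij].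
exact: val_inj.
Qed.

Lemma residueK (x : twisted T) : residue (nat_of_ord x) = x.
Proof. by apply: val_inj; rewrite /= modn_small. Qed.

(** The residue i stands for y^i t^(-ih) in the split extension of the
    introduction, where t^(-h) acts on y as the power p. *)
Definition twisted_mul (x y : twisted T) : twisted T := residue (x + p ^ x * y).
Definition twisted_inv (x : twisted T) : twisted T :=
  residue ((Q - x) * p ^ (Q.-1 * x)).

(** A residue may be replaced by any representative, also in the exponent of
    the base, because N divides Q. *)
Lemma twisted_mul_residue i j :
  twisted_mul (residue i) (residue j) = residue (i + p ^ i * j).
Proof.
apply/residueP; rewrite /= modnDml; apply: modn_addl.
rewrite modnMmr -modnMml -[RHS]modnMml; congr (_ * _ %% _).
by apply: expn_mod (base_period T) _; apply: modn_period; rewrite modn_mod.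
Qed.

Lemma twisted_mulA : associative twisted_mul.
Proof.
move=> x y z; rewrite -(residueK x) -(residueK y) -(residueK z).
rewrite !twisted_mul_residue; apply/residueP; rewrite -addnA.
apply: modn_addl; rewrite mulnDr; apply: modn_addl; rewrite mulnA.
rewrite -modnMml -[RHS]modnMml; congr (_ * _ %% _); rewrite -expnD.
apply: expn_mod (base_period T) _; apply: modn_addl.
by rewrite -[RHS]modnMml base_exp1 modnMml mul1n.
Qed.

Lemma twisted_mul1 : left_id (residue 0) twisted_mul.
Proof.
by move=> x; rewrite -(residueK x) twisted_mul_residue expn0 mul1n.
Qed.

Lemma twisted_mulV : left_inverse (residue 0) twisted_inv twisted_mul.
Proof.
move=> x; rewrite /twisted_inv -{3}(residueK x) twisted_mul_residue.
set y := nat_of_ord x; have le_yQ : y <= Q by apply: ltnW; apply: (ltn_ord x).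
apply/residueP; rewrite -modnDmr -modnMml base_expM modnMml.
have -> : p ^ (Q - y) * y = p ^ (Q.-1 * y) * y %[mod Q].
  rewrite -modnMml -[RHS]modnMml; congr (_ * _ %% _).
  apply: expn_mod (base_period T) _; apply: modn_period; apply/eqP.
  rewrite -(eqn_modDr y) subnK // modnn addnC -mulSn prednK ?modulus_gt0 //.
  by rewrite modnMr.
by rewrite modnDmr mulnC -mulnDr subnK // mod0n modnMl.
Qed.

HB.instance Definition _ := Finite_isGroup.Build (twisted T)
  twisted_mulA twisted_mul1 twisted_mulV.

Local Open Scope group_scope.
Local Notation a := (residue N).
Local Notation b := (residue 1).

Lemma residueM i j : residue i * residue j = residue (i + p ^ i * j)%N.
Proof. exact: twisted_mul_residue. Qed.

Lemma residue0 : residue 0 = 1.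
Proof. by []. Qed.

Lemma residueX i k :
  residue i ^+ k = residue (i * \sum_(0 <= j < k) p ^ (i * j))%N.
Proof.
elim: k => [|k IHk]; first by rewrite big_geq // muln0.
rewrite expgSr IHk residueM big_nat_recr //= mulnDr.
apply/residueP/modn_addl; rewrite mulnC; apply: modn_mulr.
apply: expn_mod (base_period T) _; apply: modn_mulr.
by apply: modn_sum1 => j; apply: base_exp1.
Qed.

Lemma residue_periodX l : residue N ^+ l = residue (N * l)%N.
Proof.
rewrite residueX; apply/residueP/modn_mulr/modn_sum1 => j.
rewrite -(expn0 p); apply: expn_mod (base_period T) _.
by rewrite mod0n modnMr.
Qed.

Lemma residue1X k : residue 1 ^+ k = residue (\sum_(0 <= j < k) p ^ j)%N.
Proof. by rewrite residueX mul1n; under eq_bigr do rewrite mul1n. Qed.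

Lemma period_gt0 : (0 < N)%N.
Proof. exact: dvdn_gt0 (modulus_gt0 T) (period_dvd T). Qed.

Lemma base_exp_period l : p ^ (N * l) = 1 %[mod Q].
Proof.
rewrite -(expn0 p); apply: expn_mod (base_period T) _.
by rewrite mod0n modnMr.
Qed.

Lemma residue_XX l k :
  a ^+ l * b ^+ k = residue (N * l + \sum_(0 <= j < k) p ^ j)%N.
Proof.
rewrite residue_periodX residue1X residueM; apply/residueP/modn_addl.
by rewrite -modnMml base_exp_period modnMml mul1n.
Qed.

(** [b ^+ i] is a sum of i terms congruent to 1 mod N, so it differs from i by a
    multiple of N, which a power of a supplies. *)
Lemma residue_decomp i : exists l, residue i = a ^+ l * b ^+ i.
Proof.
set s := (\sum_(0 <= j < i) p ^ j)%N.
(* Adding Q * s, which is 0 mod Q, keeps the subtraction of s exact. *)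
have le_s : (s <= i + Q * s)%N.
  by apply: leq_trans (leq_addl _ _); rewrite leq_pmull ?modulus_gt0.
have /dvdnP [l lE] : N %| i + Q * s - s.
  rewrite -eqn_mod_dvd //; apply/eqP; transitivity (i %% N)%N.
    by rewrite -modnDmr -modnMml (eqP (period_dvd T)) mul0n mod0n addn0.
  by apply/esym/modn_sum1 => j; apply: base_exp1.
exists l; rewrite residue_XX mulnC -lE subnK //; apply/residueP.
by rewrite -modnDmr modnMr addn0.
Qed.

Lemma residue_conj : b * a = a ^+ p * b.
Proof.
by rewrite -[b in RHS]expg1 residue_XX big_nat1 residueM addnC mulnC.
Qed.

Lemma twisted_metacyclic : metacyclic [set: twisted T].
Proof.
have nab : b \in 'N(<[a]>).
  rewrite -groupV inE -cycleJ cycle_subG conjgE invgK mulgA residue_conj.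
  by rewrite mulgK mem_cycle.
have TE : [set: twisted T] = <[a]> * <[b]>.
  apply/esym/setP=> x; rewrite inE -(residueK x).
  have [l ->] := residue_decomp x.
  by apply/mulsgP; exists (a ^+ l) (b ^+ x); rewrite ?mem_cycle.
apply/metacyclicP; exists <[a]>%G; split; first exact: cycle_cyclic.
  rewrite /normal subsetT TE mul_subG ?normG //.
  by rewrite cycle_subG.
by rewrite TE quotientMidl quotient_cyclic ?cycle_cyclic.
Qed.

(** * Presentations of metacyclic type *)

Section BPresentation.
Variables (M : nat) (q : int) (s : nat).
Hypothesis periodM : (N * M)%N = Q.
Hypothesis q_base : (q = p%:Z %[mod M%:Z])%Z.
Hypothesis base_sum : \sum_(0 <= j < N) p ^ j = N * s %[mod Q].
Hypothesis q_gcd : (M%:Z %/ gcdz M%:Z (q - 1) = s%:Z)%Z.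

Let rels := B_relators M%:Z N%:Z q 1.
Let f (i : 'I_2) : twisted T := if i == ord0 then a else b.
Let wa : word 'I_2 := [:: (ord0, false)].
Let wb : word 'I_2 := [:: (ord_max, false)].

(** The last relator has the exponent M / (M, q - 1), here called s; both it and
    the exponent q are replaced by natural numbers, the latter by p, which is
    legitimate once a^M = 1. *)
Lemma B_relator_values (G : groupType) (g : 'I_2 -> G) :
    (forall w, w \in rels -> word_value g w = 1) <->
  [/\ g ord0 ^+ M = 1, g ord_max * g ord0 = g ord0 ^+ p * g ord_max
    & g ord_max ^+ N = g ord0 ^+ s].
Proof.
have va : word_value g wa = g ord0 by exact: word_value_letter.
have vb : word_value g wb = g ord_max by exact: word_value_letter.
have v1 : word_value g (exp_word wa M%:Z) = g ord0 ^+ M.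
  by rewrite word_value_exp va.
have v2 : g ord0 ^+ M = 1 ->
    word_value g (wb ++ wa ++ inv_word wb ++ inv_word (exp_word wa q))
    = g ord_max * g ord0 * (g ord_max)^-1 * (g ord0 ^+ p)^-1.
  move=> gM; rewrite !word_value_cat !word_value_inv vb va.
  by rewrite (word_value_expz (M := M) (m := p)) ?va ?mulgA.
have v3 : word_value g (exp_word wb N%:Z ++
    inv_word (exp_word wa ((1 * M%:Z)%R %/ gcdz M%:Z (q - 1))%Z))
    = g ord_max ^+ N * (g ord0 ^+ s)^-1.
  by rewrite mul1r q_gcd word_value_cat word_value_inv !word_value_exp va vb.
split=> [gR|[gM gC gN] w].
  have gM : g ord0 ^+ M = 1 by rewrite -v1 gR // mem_head.
  split=> //.
    apply/eqP; rewrite -divg_eq -divg_eq1 -v2 // gR //.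
    by rewrite /rels !in_cons eqxx orbT.
  by apply/divg1_eq; rewrite -v3 gR // /rels !in_cons eqxx !orbT.
rewrite /rels !in_cons orbF => /or3P[] /eqP ->.
- by rewrite v1.
- by rewrite v2 // gC mulgK divgg.
- by rewrite v3 gN divgg.
Qed.

(** The relations let b move past a, so every element is some a^l b^k.  If such
    an element is sent to 0, then N divides k by reduction mod N, so b^k is a
    power of a as well, and M divides the resulting exponent of a because N M = Q:
    the morphism is injective.  It is surjective by [residue_decomp]. *)
Lemma B_group_iso_twisted : group_iso (B_group M%:Z N%:Z q 1) (twisted T).
Proof.
have M_gt0 : (0 < M)%N by move: (modulus_gt0 T); rewrite -periodM muln_gt0 => /andP[].
have [phi phiE] : exists phi : UMagmaMorphism.type (presented rels) (twisted T),
    forall x, phi (presented_gen rels x) = f x.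
  apply: presented_morphism; apply/B_relator_values; rewrite /f /=; split.
  - by rewrite residue_periodX periodM; apply/residueP; rewrite modnn mod0n.
  - exact: residue_conj.
  - by rewrite residue1X residue_periodX; apply/residueP.
pose ga := presented_gen rels ord0; pose gb := presented_gen rels ord_max.
have phia : phi ga = a by rewrite phiE.
have phib : phi gb = b by rewrite phiE.
have [gaM gC gbN] : [/\ ga ^+ M = 1, gb * ga = ga ^+ p * gb & gb ^+ N = ga ^+ s].
  by apply/B_relator_values => w; apply: presented_gen_rel.
have gCX l : gb * ga ^+ l = ga ^+ (p * l) * gb.
  elim: l => [|l IHl]; first by rewrite muln0 mulg1 mul1g.
  by rewrite expgSr mulgA IHl -mulgA gC mulgA -expgnDr mulnSr.
have gbNM : gb ^+ (N * M) = 1 by rewrite expgnA gbN -expgnA mulnC expgnA gaM expg1n.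
(* Both generators have finite order, so inverses need no separate treatment. *)
have invX (G : groupType) (g : G) k : (0 < k)%N -> g ^+ k = 1 -> g^-1 = g ^+ k.-1.
  by move=> k_gt0 gk; apply: mulg1_eq; rewrite -expgS prednK.
pose nf (g : presented rels) := exists l k, g = ga ^+ l * gb ^+ k.
have nfa g : nf g -> nf (ga * g).
  by case=> l [k ->]; exists l.+1, k; rewrite mulgA -expgS.
have nfb g : nf g -> nf (gb * g).
  case=> l [k ->]; exists (p * l)%N, k.+1.
  by rewrite mulgA gCX -mulgA -expgS.
have nfX x m g : (forall g, nf g -> nf (x * g)) -> nf g -> nf (x ^+ m * g).
  move=> nfx nfg; elim: m => [|m IHm]; first by rewrite mul1g.
  by rewrite expgS -mulgA; apply: nfx.
have ordE (x : 'I_2) : x = ord0 \/ x = ord_max.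
  by case: x => [[|[|//]] ?]; [left|right]; apply: val_inj.
have nfT g : nf g.
  elim/(@presented_ind _ rels): g => [|x g nfg|x g nfg].
  - by exists 0%N, 0%N; rewrite mulg1.
  - by case: (ordE x) => ->; [apply: nfa|apply: nfb].
  case: (ordE x) => ->.
    by rewrite (invX _ _ M) //; apply: nfX.
  by rewrite (invX _ _ (N * M)%N) ?periodM ?modulus_gt0 -?periodM //; apply: nfX.
have phi_inj : injective phi.
  apply: gmulf_inj => g; have [l [k ->]] := nfT g.
  rewrite gmulfM !gmulfXn phia phib residue_XX -residue0 => /residueP img1.
  have /dvdnP [k' kE] : N %| k.
    rewrite /dvdn -[X in X == _](modn_sum1 k (fun j => base_exp1 j)).
    move/modn_period: img1; rewrite mod0n -modnDml modnMr add0n.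
    by move/eqP.
  have gE : ga ^+ l * gb ^+ k = ga ^+ (l + s * k').
    by rewrite kE mulnC expgnA gbN -expgnA -expgnDr.
  move: img1; rewrite -residueP -residue_XX -phia -phib -!gmulfXn -gmulfM gE.
  rewrite gmulfXn phia residue_periodX => /residueP /eqP.
  rewrite mod0n -periodM; rewrite -/(dvdn _ _) dvdn_pmul2l ?period_gt0 //.
  by case/dvdnP=> t ->; rewrite mulnC expgnA gaM expg1n.
have phi_surj (x : twisted T) : exists g, phi g == x.
  rewrite -(residueK x); have [l ->] := residue_decomp x.
  by exists (ga ^+ l * gb ^+ x); rewrite gmulfM !gmulfXn phia phib.
apply: (@group_iso_morph _ _ phi); first exact: gmulfM.
by apply: (inj_surj_bij phi_inj (g := fun x => xchoose (phi_surj x))) => x;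
  apply/eqP/(xchooseP (phi_surj x)).
Qed.

End BPresentation.

End TwistedGroup.

(** * Relations of a cyclic presentation *)

Section CyclicPresentation.
Variables (n : nat) (n_gt0 : (0 < n)%N).
Local Open Scope ring_scope.

Lemma subscript_mod (i j : int) :
  (i = j %[mod n%:Z])%Z -> subscript n_gt0 i = subscript n_gt0 j.
Proof. by move=> ij; apply: val_inj; rewrite /= ij. Qed.

Lemma subscriptE (i : int) : (subscript n_gt0 i)%:Z = (i %% n%:Z)%Z.
Proof. by rewrite /= gez0_abs ?modz_ge0 ?eqz_nat -?lt0n. Qed.

Lemma subscriptK (m : 'I_n) : subscript n_gt0 m = m.
Proof. by apply: val_inj; rewrite /= modz_small ?absz_nat ?ltz_nat ?ltn_ord. Qed.

Lemma ordS_subscript (i : int) : ordS (subscript n_gt0 i) = subscript n_gt0 (i + 1).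
Proof.
apply: val_inj; apply/eqP; rewrite -eqz_nat subscriptE -modz_nat -addn1 PoszD.
by rewrite subscriptE modzDml.
Qed.

Lemma iter_shift_cat s (u v : word 'I_n) :
  iter s (@shift_word n) (u ++ v)
  = iter s (@shift_word n) u ++ iter s (@shift_word n) v.
Proof. by elim: s => //= s ->; rewrite /shift_word map_cat. Qed.

Lemma iter_shift_inv s (u : word 'I_n) :
  iter s (@shift_word n) (inv_word u) = inv_word (iter s (@shift_word n) u).
Proof.
elim: s => //= s ->; rewrite /shift_word /inv_word map_rev -!map_comp.
by congr rev; apply: eq_map.
Qed.

Lemma iter_shift_progression s m (i f : int) :
  iter s (@shift_word n) (progression_word n_gt0 m i f)
  = progression_word n_gt0 m (i + s%:Z) f.
Proof.
elim: s => [|s IHs]; first by rewrite addr0.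
rewrite iterS IHs /shift_word /progression_word -map_comp; apply: eq_map => j.
rewrite /= ordS_subscript; congr (subscript _ _, _).
by rewrite intS; ring.
Qed.

Lemma progression_value (G : groupType) (g : 'I_n -> G) m (i f : int) :
  word_value g (progression_word n_gt0 m i f)
  = (\prod_(0 <= j < m) g (subscript n_gt0 (i + j%:Z * f)))%g.
Proof. by rewrite /word_value /progression_word big_map /index_iota subn0. Qed.

Variables (r : nat) (k h : int).

Let c := (r%:Z - 1) * h + k.

Definition R_relators : seq (word 'I_n) :=
  [seq iter j (@shift_word n) (progression_word n_gt0 r 0 h
     ++ inv_word (progression_word n_gt0 1 (c + 1 - 1) h)) | j <- iota 0 n].

(** The n shifted relators give the relation at each subscript below n, and
    subscripts are read mod n: the relation holds at every integer. *)
Lemma R_relator_values (G : groupType) (g : 'I_n -> G) :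
    (forall w, w \in R_relators -> word_value g w = 1%g) <->
  forall i : int, (\prod_(0 <= j < r) g (subscript n_gt0 (i + j%:Z * h)))%g
    = g (subscript n_gt0 (i + c)).
Proof.
have val s : word_value g (iter s (@shift_word n) (progression_word n_gt0 r 0 h
     ++ inv_word (progression_word n_gt0 1 (c + 1 - 1) h)))
    = (\prod_(0 <= j < r) g (subscript n_gt0 (s%:Z + j%:Z * h))
       * (g (subscript n_gt0 (s%:Z + c)))^-1)%g.
  rewrite iter_shift_cat iter_shift_inv !iter_shift_progression.
  rewrite word_value_cat word_value_inv !progression_value big_nat1 add0r.
  by rewrite mul0r addr0 addrK [c + _]addrC.
split=> [gR i|gR w /mapP[s _ ->]]; last by rewrite val gR mulgV.
have /gR : iter (subscript n_gt0 i) (@shift_word n) (progression_word n_gt0 r 0 h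
     ++ inv_word (progression_word n_gt0 1 (c + 1 - 1) h)) \in R_relators.
  by apply: map_f; rewrite mem_iota ltn_ord.
rewrite val subscriptE => /divg1_eq eq_i.
have sE m : subscript n_gt0 (i + m) = subscript n_gt0 ((i %% n)%Z + m).
  by apply: subscript_mod; rewrite modzDml.
by rewrite sE -eq_i; apply: eq_bigr => j _; rewrite sE.
Qed.

End CyclicPresentation.

(** * Products along an arithmetic progression of generators *)

(** [run m i] is x_m x_(m+h) ... x_(m+(i-1)h), that is t^m y^i t^(-ih) t^(-m) in
    the extended group of the introduction.  It is studied for an arbitrary
    family x of elements of a group, since it is used both for the generators
    of the presented group and for their images. *)
Section Runs.
Variables (n r : nat) (h c A : int) (G : groupType) (x : int -> G).
Local Open Scope ring_scope.
Variables (t u : int).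
Hypothesis h_period : h * (r%:Z - 1) = t * n%:Z.
Hypothesis x_mod : forall i j, (i = j %[mod n%:Z])%Z -> x i = x j.

Definition run (m : int) (i : nat) : G := (\prod_(0 <= j < i) x (m + j%:Z * h))%g.

Hypothesis run_r : forall m, run m r = x (m + c).

Lemma run_add m i j : run m (i + j) = (run m i * run (m + i%:Z * h)%R j)%g.
Proof.
elim: j => [|j IHj]; first by rewrite addn0 [run (_ + _) 0]big_geq // mulg1.
rewrite addnS /run !big_nat_recr //= -!/(run _ _) IHj mulgA.
by congr (_ * x _)%g; rewrite PoszD; ring.
Qed.

Lemma run_mod m m' i : (m = m' %[mod n%:Z])%Z -> run m i = run m' i.
Proof.
by move=> mm; apply: eq_bigr => j _; apply: x_mod; rewrite -modzDml mm modzDml.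
Qed.

Lemma run1 m : run m 1 = x m.
Proof. by rewrite /run big_nat1 mul0r addr0. Qed.

(** Grouping the factors r at a time: each group is a generator, and the groups
    start at steps of r h, which is h mod n. *)
Lemma run_mulr m i : run m (r * i) = run (m + c) i.
Proof.
elim: i m => [|i IHi] m; first by rewrite muln0 /run !big_geq.
rewrite mulnS run_add run_r IHi -[i.+1]add1n run_add run1; congr (_ * _)%g.
apply: run_mod; apply: (modz_shift (t := t)).
by rewrite mul1r -h_period; ring.
Qed.

Lemma run_expr m s i : run m (r ^ s * i) = run (m + s%:Z * c) i.
Proof.
elim: s m => [|s IHs] m; first by rewrite mul1n mul0r addr0.
by rewrite expnS -mulnA run_mulr IHs; congr run; rewrite intS; ring.
Qed.

Hypothesis r_gt0 : (0 < r)%N.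

(** r^n consecutive factors collapse, by n regroupings, to the generator they
    start with, since n c is 0 mod n; the r^n - 1 others are thus trivial. *)
Lemma run_modulus m : run m (r ^ n - 1) = 1%g.
Proof.
(* The product of length r^n - 1 left after the first factor starts one step
   further, whence the start at m - h. *)
have: run (m - h) (1 + (r ^ n - 1)) = run (m - h) 1.
  rewrite subnKC ?expn_gt0 ?r_gt0 // -[X in run _ X]muln1 run_expr.
  by apply: run_mod; apply: (modz_shift (t := c)); ring.
rewrite run_add mul1r subrK => eq1.
by apply: (mulgI (run (m - h) 1)); rewrite mulg1.
Qed.

Lemma run_modn m i j : i = j %[mod r ^ n - 1] -> run m i = run m j.
Proof.
have runQ m' s : run m' (s * (r ^ n - 1)) = 1%g.
  elim: s m' => [|s IHs] m'; first by rewrite /run big_geq.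
  by rewrite mulSn run_add run_modulus IHs mul1g.
have runE i' : run m i' = run m (i' %% (r ^ n - 1)).
  rewrite {1}(divn_eq i' (r ^ n - 1)) run_add runQ mul1g; apply: run_mod.
  (* r - 1 divides r^n - 1, so a full period of factors shifts the subscript by
     a multiple of h (r - 1), which is 0 mod n. *)
  have [s sE] : exists s : int, ((r ^ n - 1)%N : int) = (r%:Z - 1) * s.
    exists (\sum_(j < n) r ^ j)%N%:Z; rewrite subn1 predn_exp PoszM.
    by rewrite -subn1 -subzn.
  apply: (modz_shift (t := (i' %/ (r ^ n - 1))%N%:Z * s * t)).
  by rewrite -mulrA -h_period PoszM sE; ring.
by move=> ij; rewrite runE ij -runE.
Qed.

Hypothesis A_inverse : c * A = 1 + u * n%:Z.

Lemma run_gen m s : (s%:Z = m * A %[mod n%:Z])%Z -> run 0 (r ^ s) = x m.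
Proof.
move=> sE; rewrite -[X in run _ X]muln1 run_expr run1; apply: x_mod.
rewrite add0r -modzMml sE modzMml; apply: (modz_shift (t := m * u)).
by rewrite -mulrA [A * c]mulrC A_inverse; ring.
Qed.

(** The second factor must start at i h to be appended to the first.  It does so
    after e i regroupings, since e c = - h mod n, and these multiply its length
    by r^(e i). *)
Lemma run_mul e i j : (e%:Z = (n%:Z - 1) * h * A %[mod n%:Z])%Z ->
  (run 0 i * run 0 j)%g = run 0 (i + (r ^ e) ^ i * j).
Proof.
move=> /eqP; rewrite eqz_mod_dvd => /dvdzP[v eE].
rewrite run_add -expnM run_expr; congr (_ * _)%g; apply: run_mod.
apply/esym; apply: (modz_shift (t := i%:Z * (h + v * c + (n%:Z - 1) * h * u))).
rewrite PoszM; have -> : e%:Z = v * n%:Z + (n%:Z - 1) * h * A by rewrite -eE; ring.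
transitivity (i%:Z * h + i%:Z * c * v * n%:Z + i%:Z * (n%:Z - 1) * h * (c * A)).
  by ring.
by rewrite A_inverse; ring.
Qed.

End Runs.

(** * The cyclically presented group is a twisted cyclic group *)

Section RTwisted.
Variables (n r : nat) (h k A : int) (t u : int) (T : twist) (e : nat).
Hypotheses (n_gt0 : 0 < n) (r_gt0 : 0 < r).
Local Open Scope ring_scope.
Let c := (r%:Z - 1) * h + k.
Hypothesis h_period : h * (r%:Z - 1) = t * n%:Z.
Hypothesis A_inverse : c * A = 1 + u * n%:Z.
Hypothesis eE : (e%:Z = (n%:Z - 1) * h * A %[mod n%:Z])%Z.
Hypothesis T_modulus : modulus T = (r ^ n - 1)%N.
Hypothesis T_base : base T = (r ^ e)%N.
Hypothesis r1 : (r = 1 %[mod period T])%N.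

Local Notation rp := (rpow n r).
Local Open Scope group_scope.

(** The image of x_i = t^i x_0 t^(-i): conjugation by t is the power r^A on the
    cyclic normal subgroup, because c A = 1 mod n. *)
Let y (i : int) : twisted T := residue T (rp (i * A)%R).

Lemma rpow1 z : (rp z = 1 %[mod period T])%N.
Proof. by rewrite /rpow -modnXm r1 modnXm exp1n. Qed.

(** The twist cancels the growth of the factors: p^j times the image of the j-th
    factor is the image of the first one, so the products are plain multiples. *)
Lemma run_y m i : run h y m i = residue T (i * rp (m * A)%R).
Proof.
elim: i => [|i IHi]; first by rewrite /run big_geq.
rewrite /run big_nat_recr //= -/(run _ _ _ _) IHi residueM mulSn addnC.
apply/residueP/modn_addr.
have bE : base T ^ (i * rp (m * A)%R) = base T ^ i %[mod modulus T].
  apply: expn_mod (base_period T) _.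
  by rewrite -modnMmr rpow1 modnMmr muln1.
rewrite -modnMml bE T_base -expnM T_modulus modnMml -modnMml.
rewrite -(rpow_nat n_gt0 r_gt0 (e * i)) modnMml -rpowD //.
congr (_ %% _)%N; apply: rpow_mod; rewrite PoszM -modzDml -modzMml eE modzMml modzDml.
by apply: (modz_shift (t := (h * A * i%:Z)%R)); ring.
Qed.

(** [phi] comes from the universal property, its relations being the case i = r
    of [run_y]; [psi] sends i to the product of length i starting at x_0.  They
    are inverse to each other on generators, hence everywhere. *)
Lemma R_group_iso_twisted : group_iso (R_group n_gt0 r k h) (twisted T).
Proof.
pose rels := R_relators n_gt0 r k h.
pose x (i : int) := presented_gen rels (subscript n_gt0 i).
have x_mod i j : (i = j %[mod n%:Z])%Z -> x i = x j.
  by move=> ij; rewrite /x (subscript_mod n_gt0 ij).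
have x_r m : run h x m r = x (m + c)%R.
  have /R_relator_values : forall w, w \in rels -> word_value (presented_gen rels) w = 1.
    exact: presented_gen_rel.
  by move/(_ m).
have [phi phiE] : exists phi : UMagmaMorphism.type (presented rels) (twisted T),
    forall m : 'I_n, phi (presented_gen rels m) = y m%:Z.
  apply: presented_morphism; apply/R_relator_values => i.
  have yE j : y (subscript n_gt0 j) = y j.
    by congr (residue T _); apply: rpow_mod; rewrite subscriptE modzMml.
  under eq_bigr do rewrite yE.
  rewrite -/(run h y i r) run_y yE; apply/residueP.
  have r_rp : (r = rp 1 %[mod r ^ n - 1])%N by rewrite rpow_nat // expn1.
  rewrite T_modulus -modnMml r_rp modnMml -rpowD //.
  congr (_ %% _)%N; apply: rpow_mod; rewrite mulrDl A_inverse.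
  by apply: (modz_shift (t := (- u)%R)); ring.
have phix i : phi (x i) = y i.
  by rewrite phiE; congr (residue T _); apply: rpow_mod; rewrite subscriptE modzMml.
pose psi (z : twisted T) : presented rels := run h x 0 z.
have psiM : {morph psi : z w / z * w}.
  move=> z w; rewrite /psi (run_mul h_period x_mod x_r A_inverse _ _ eE).
  apply: (run_modn h_period x_mod x_r r_gt0).
  by rewrite -T_modulus -T_base modn_mod.
have psiK : cancel psi phi.
  move=> z; rewrite /psi gmulf_prod; under eq_bigr do rewrite phix.
  rewrite -/(run h y 0 z) run_y mul0r /rpow mod0z muln1; exact: residueK.
have psi_gen m : psi (phi (presented_gen rels m)) = presented_gen rels m.
  rewrite phiE /psi.
  transitivity (run h x 0 (rp (m%:Z * A)%R)).
    apply: (run_modn h_period x_mod x_r r_gt0).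
    by rewrite -T_modulus /= modn_mod.
  rewrite (run_gen h_period x_mod x_r A_inverse (m := m%:Z)).
    by rewrite /x subscriptK.
  by rewrite absz_modz // modz_mod.
have psi1 : psi 1 = 1 by rewrite /psi /run big_geq //= mod0n.
have phiK : cancel phi psi.
  elim/(@presented_ind _ rels) => [|m g IHg|m g IHg].
  - by rewrite gmulf1.
  - by rewrite gmulfM psiM psi_gen IHg.
  rewrite gmulfM psiM IHg gmulfV; congr (_ * _).
  apply/esym/mulg1_eq; rewrite -[X in X * _]psi_gen -psiM mulgV.
  exact: psi1.
apply: (@group_iso_morph _ _ phi); first exact: gmulfM.
by exists psi.
Qed.

End RTwisted.

(** * The theorem *)

Local Open Scope ring_scope.

Theorem corollary9 (n : nat) (r : nat) (k h : int) (n_gt0 : (0 < n)%N)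
    (coprime_nk : gcdz n%:Z k = 1) (r_gt1 : (1 < r)%N)
    (h_period : (h * (r%:Z - 1) = 0 %[mod n%:Z])%Z)
    (A : int) (A_inverse : (((r%:Z - 1) * h + k) * A = 1 %[mod n%:Z])%Z)
    (q : int)
    (q_power : represents_power (r%:Z ^+ n - 1) r%:Z ((n%:Z - 1) * h * A) q) :
  let M := ((gcdz n%:Z h * (r%:Z ^+ n - 1)) %/ n%:Z)%Z in
  let N := (n %/ gcdn n `|h|)%N in
  [/\ (q ^+ N = 1 %[mod M])%Z,
      group_iso (R_group n_gt0 r k h) (B_group M N%:Z q 1)
    & exists gT : finGroupType,
        [/\ group_iso (R_group n_gt0 r k h) gT,
            metacyclic [set: gT]
          & #|[set: gT]| = (r ^ n - 1)%N]].
Proof.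
move=> M N; have r_gt0 : (0 < r)%N by apply: ltnW.
pose Q := (r ^ n - 1)%N; pose d := gcdn n `|h|.
have Q_gt0 : (0 < Q)%N by rewrite subn_gt0 -{1}(expn0 r) ltn_exp2l.
have d_gt0 : (0 < d)%N by rewrite gcdn_gt0 n_gt0.
have Nd : (N * d)%N = n by rewrite divnK // dvdn_gcdl.
have /dvdzP[t tE] : (n%:Z %| h * (r%:Z - 1))%Z.
  by apply/dvdz_mod0P; rewrite h_period mod0z.
have /dvdzP[u uE] : (n%:Z %| ((r%:Z - 1) * h + k) * A - 1)%Z.
  by rewrite -eqz_mod_dvd; apply/eqP.
have {}uE : ((r%:Z - 1) * h + k) * A = 1 + u * n%:Z by rewrite -uE; ring.
(* e represents -hA mod n, so q is r^e mod Q. *)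
pose E := (n%:Z - 1) * h * A; pose e := `|(E %% n%:Z)%Z|%N.
have eE : (e%:Z = E %[mod n%:Z])%Z by rewrite absz_modz // modz_mod.
(* A and -1 are units mod n. *)
have e_gcd : gcdn n e = d.
  apply/eqP; rewrite -eqz_nat -[_%:Z]/(gcdz n%:Z (E %% n%:Z)%Z) gcdz_modr.
  have cA : coprimez n%:Z A.
    apply/coprimezP; exists (- u, (r%:Z - 1) * h + k).
    by rewrite /= uE; ring.
  have cn : coprimez n%:Z (n%:Z - 1).
    by apply/coprimezP; exists (1, -1); rewrite /=; ring.
  by rewrite Gauss_gcdzl // Gauss_gcdzr.
have N_dvd_r : (N %| r - 1)%N.
  rewrite -(Gauss_dvdr _ (gcdn_divn_coprime `|h| n_gt0)) -(dvdn_pmul2r d_gt0).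
  rewrite Nd mulnAC divnK ?dvdn_gcdr //.
  have := dvdz_mull t (dvdzz n%:Z); rewrite -tE subzn // dvdzE.
  by rewrite abszM !absz_nat.
have r1 : (r = 1 %[mod N])%N by apply/eqP; rewrite eqn_mod_dvd.
have N_dvd_Q : (N %| Q)%N.
  by rewrite -eqn_mod_dvd ?expn_gt0 ?r_gt0 // -modnXm r1 modnXm exp1n.
have d_dvd_e : (d %| e)%N by rewrite -e_gcd dvdn_gcdr.
have base_N : ((r ^ e) ^ N = 1 %[mod Q])%N.
  rewrite -expnM -(expn0 r); apply: expn_mod (expn_modulus n r_gt0) _.
  by apply/eqP; rewrite mod0n -/(dvdn _ _) -{1}Nd mulnC dvdn_mul.
have base_1 : (r ^ e = 1 %[mod N])%N by rewrite -modnXm r1 modnXm exp1n.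
pose T := Twist Q_gt0 N_dvd_Q base_N base_1.
pose D := (r ^ d - 1)%N; pose S := (\sum_(0 <= j < N) (r ^ d) ^ j)%N.
have DS : (D * S)%N = Q.
  by rewrite /D /S /Q !subn1 big_mkord -predn_exp -expnM mulnC Nd.
(* S is a sum of N terms congruent to 1 mod N. *)
have /dvdnP[s sE] : (N %| S)%N.
  rewrite /dvdn /S (modn_sum1 (m := N)) ?modnn // => j.
  by rewrite -expnM -modnXm r1 modnXm exp1n.
have ME : M = (D * s)%N%:Z.
  rewrite /M; have -> : (r%:Z ^+ n - 1)%R = Q%:Z.
    by rewrite -subzn ?expn_gt0 ?r_gt0 // PoszX.
  rewrite -[gcdz _ _]/d%:Z -DS sE -PoszM.
  have -> : (d * (D * (s * N)) = D * s * n)%N by rewrite -Nd; ring.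
  by rewrite PoszM mulzK // eqz_nat -lt0n.
have NM : (N * (D * s))%N = Q by rewrite -DS sE; ring.
have Ds_gt0 : (0 < D * s)%N by have := Q_gt0; rewrite -NM muln_gt0 => /andP[].
have qQ : (q = (r ^ e)%N%:Z %[mod Q%:Z])%Z.
  exact: represents_power_rpow q_power.
have qM : (q = (r ^ e)%N%:Z %[mod (D * s)%N%:Z])%Z.
  apply/eqP; rewrite eqz_mod_dvd; apply: (@dvdz_trans Q%:Z).
    by rewrite -NM PoszM dvdz_mull.
  by rewrite -eqz_mod_dvd qQ.
(* e/d is prime to N = n/d, since d = (n,e). *)
have base_sum : (\sum_(0 <= j < N) (r ^ e) ^ j = N * s %[mod Q])%N.
  rewrite mulnC -sE -(divnK d_dvd_e) [(_ * d)%N]mulnC expnM.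
  apply: sum_exp_coprime.
    by rewrite -expnM mulnC Nd; apply: expn_modulus.
  by have := gcdn_divn_coprime e n_gt0; rewrite e_gcd.
(* D divides M = D s and r^e - 1, while (M, r^e - 1) divides (Q, r^e - 1) = D. *)
have q_gcd : ((D * s)%N%:Z %/ gcdz (D * s)%N%:Z (q - 1) = s%:Z)%Z.
  have -> : gcdz (D * s)%N%:Z (q - 1) = D%:Z.
    rewrite -gcdz_modr -modzDml qM modzDml gcdz_modr.
    rewrite subzn ?expn_gt0 ?r_gt0 //; apply/eqP; rewrite eqz_nat eqn_dvd.
    have DE : gcdn Q (r ^ e - 1) = D by rewrite gcdn_exp_pred // e_gcd.
    have Ds_dvd_Q : (D * s %| Q)%N by rewrite -NM dvdn_mull.
    apply/andP; split; last by rewrite dvdn_gcd dvdn_mulr //= -{1}DE dvdn_gcdr.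
    by rewrite -{2}DE dvdn_gcd dvdn_gcdr (dvdn_trans (dvdn_gcdl _ _)).
  rewrite PoszM mulKz // eqz_nat -lt0n.
  by move: Ds_gt0; rewrite muln_gt0 => /andP[].
have R_T : group_iso (R_group n_gt0 r k h) (twisted T).
  exact: (R_group_iso_twisted (t := t) (u := u) (e := e) n_gt0 r_gt0 tE uE eE).
split.
- rewrite ME; apply/eqP; rewrite eqz_mod_dvd; apply: (@dvdz_trans Q%:Z).
    by rewrite -NM PoszM dvdz_mull.
  rewrite -eqz_mod_dvd -modzXm qQ modzXm -PoszX !modz_nat eqz_nat.
  exact/eqP.
- apply: group_iso_trans R_T _; apply: group_iso_sym; rewrite ME.
  exact: (B_group_iso_twisted (T := T) NM qM base_sum q_gcd).
exists (twisted T); split => //; first exact: twisted_metacyclic.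
by rewrite cardsT card_ord.
Qed.
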